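(* Let $(M,\varphi,\xi_i,\eta^j,g)$ be an almost $\mathcal{S}$-manifold. For any $f\in C^\infty(M)$ define $X_f$ to be the vector field such that $\iota(X_f)\eta^i=f$ for each $i=1,\dots,k$ and $\iota(X_f)\Phi=df-(\overline{\xi}\cdot f)\overline{\eta}$, and define a bracket on $C^\infty(M)$ by $\{f,g\}=\iota([X_f,X_g])\overline{\eta}=X_f\cdot g-(\overline{\xi}\cdot f)g$. Then the vector field $X_{\{f,g\}}$ corresponding to the function $\{f,g\}$ is given by $$X_{\{f,g\}}=[X_f,X_g].$$
   Context: A metric $f\cdot$pk-structure $(\varphi,\xi_i,\eta^j,g)$ on a smooth manifold $M$ of dimension $2n+k$ consists of $\varphi\in\Gamma(M,\mathrm{End}(TM))$ of rank $2n$ with $\varphi^3+\varphi=0$, a global frame $\xi_1,\dots,\xi_k$ of $\ker\varphi$, 1-forms $\eta^1,\dots,\eta^k$ with $\eta^i(\xi_j)=\delta^i_j$, $\eta^j\circ\varphi=0$, $\varphi^2=-\mathrm{Id}+\sum_i\eta^i\otimes\xi_i$, and a Riemannian metric $g$ with $g(X,Y)=g(\varphi X,\varphi Y)+\sum_i\eta^i(X)\eta^i(Y)$. The fundamental 2-form is $\Phi(X,Y)=g(\varphi X,Y)$. The structure is an almost $\mathcal{S}$-structure (and $M$ an almost $\mathcal{S}$-manifold) if $\Phi=-d\eta^i$ for every $i=1,\dots,k$. Notation: $\overline{\xi}=\sum_{i=1}^k\xi_i$, $\overline{\eta}=\frac1k\sum_{i=1}^k\eta^i$; $Y\cdot f$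 is the derivative of $f$ along $Y$, and $\iota$ denotes contraction. The value of $\{f,g\}$ does not change if $\overline{\eta}$ is replaced in $\iota([X_f,X_g])\overline{\eta}$ by any of the $\eta^i$. (The letter $g$ denotes both the metric and a function.)
   Formalization: For k ≥ 2 the vector field X_f does not exist for every f (its equations force all ξ_j·f to be equal), so the result is stated for those f, g for which X_f and X_g exist, with k ≥ 1; it is proved that X_{{f,g}} then exists, is unique and equals [X_f,X_g]. *)

(* Defs.v *)
From HB Require Import structures.
From mathcomp Require Import all_boot all_order all_algebra.
From mathcomp Require Import all_classical all_reals all_analysis.
From mathcomp Require Import ring.

Set Implicit Arguments.
Unset Strict Implicit.
Unset Printing Implicit Defensive.

Import Order.TTheory GRing.Theory Num.Theory.
Import numFieldNormedType.Exports.

Local Open Scope classical_set_scope.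
Local Open Scope ring_scope.

Section SmoothOn.
Context {R : realType} {m : nat}.
Implicit Types (U : set 'rV[R]_m) (f g : 'rV[R]_m -> R).

(* C^r on U through iterated partial derivatives; meant for open U. *)
Fixpoint Ck_on (r : nat) U f : Prop :=
  (forall x, U x -> {for x, continuous f}) /\
  if r is r'.+1 then
    forall i : 'I_m, (forall x, U x -> derivable f x (delta_mx 0 i)) /\
      Ck_on r' U (fun x => 'D_(delta_mx 0 i) f x)
  else True.

Definition smooth_on U f : Prop := forall r, Ck_on r U f.

Lemma Ck_onS r U f : Ck_on r.+1 U f -> Ck_on r U f.
Proof.
elim: r f => [|r IH] f; first by case.
case=> fc fd; split=> // i; have [fi Dfi] := fd i.
by split=> //; exact: IH.
Qed.

Lemma eq_Ck_on r U f g : open U -> (forall x, U x -> f x = g x) ->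
  Ck_on r U f -> Ck_on r U g.
Proof.
move=> oU; have nearU x : U x -> \forall y \near x, U y.
  by move=> Ux; exact: open_nbhs_nbhs.
have cg f' g' : (forall x, U x -> f' x = g' x) ->
    (forall x, U x -> {for x, continuous f'}) ->
    forall x, U x -> {for x, continuous g'}.
  move=> fg cf x Ux; rewrite /prop_for /continuous_at -(fg _ Ux).
  apply: cvg_trans (cf _ Ux); apply: (@near_eq_cvg _ _ (nbhs x)).
  by apply: filterS (nearU x Ux) => y; exact: fg.
elim: r f g => [|r IH] f g fg [cf Df]; split=> //; try exact: cg cf.
move=> i; have [di Di] := Df i.
have fgn x : U x -> \forall y \near x, f y = g y.
  by move=> Ux; apply: filterS (nearU x Ux) => y; exact: fg.
split=> [x Ux|].
  by apply: near_eq_derivable (di x Ux) => //; exact: fgn.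
by apply: IH Di => x Ux; apply: near_eq_derive => //; exact: fgn.
Qed.

Lemma Ck_on_cst r U (c : R) : Ck_on r U (fun=> c).
Proof.
elim: r c => [|r IH] c; split=> //; try by move=> x _; exact: cst_continuous.
move=> i; split=> [x _|]; first exact: derivable_cst.
have -> : (fun x : 'rV[R]_m => 'D_(delta_mx 0 i) (fun=> c) x) = fun=> 0.
  by apply/funext => x; exact: derive_cst.
exact: IH.
Qed.

Lemma Ck_onD r U f g : open U -> Ck_on r U f -> Ck_on r U g ->
  Ck_on r U (fun x => f x + g x).
Proof.
move=> oU; elim: r f g => [|r IH] f g [cf Df] [cg Dg]; split=> //;
  try by move=> x Ux; apply: continuousD; [exact: cf|exact: cg].
move=> i; have [dfi Dfi] := Df i; have [dgi Dgi] := Dg i.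
split=> [x Ux|]; first by apply: derivableD; [exact: dfi|exact: dgi].
apply: eq_Ck_on (IH _ _ Dfi Dgi) => // x Ux.
by rewrite -deriveD //; [exact: dfi|exact: dgi].
Qed.

Lemma Ck_onM r U f g : open U -> Ck_on r U f -> Ck_on r U g ->
  Ck_on r U (fun x => f x * g x).
Proof.
move=> oU; elim: r f g => [|r IH] f g Cf Cg.
  case: Cf Cg => [cf Df] [cg Dg]; split=> //.
  by move=> x Ux; apply: continuousM; [exact: cf|exact: cg].
have Cf' := Ck_onS Cf; have Cg' := Ck_onS Cg.
case: Cf Cg => [cf Df] [cg Dg]; split=> //.
  by move=> x Ux; apply: continuousM; [exact: cf|exact: cg].
move=> i; have [dfi Dfi] := Df i; have [dgi Dgi] := Dg i.
split=> [x Ux|]; first by apply: derivableM; [exact: dfi|exact: dgi].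
apply: eq_Ck_on (Ck_onD oU (IH _ _ Cf' Dgi) (IH _ _ Cg' Dfi)) => // x Ux.
exact: esym (deriveM (dfi _ Ux) (dgi _ Ux)).
Qed.

End SmoothOn.

(* A homeomorphism from an open subset of T onto an open subset of R^m; only
   the values of chart_map on chart_dom and of chart_inv on its image matter. *)
Record chart (R : realType) (m : nat) (T : topologicalType) := Chart {
  chart_dom : set T;
  chart_map : T -> 'rV[R]_m;
  chart_inv : 'rV[R]_m -> T;
  chart_dom_open : open chart_dom;
  chart_cod_open : open (chart_map @` chart_dom);
  chart_mapK : forall x, chart_dom x -> chart_inv (chart_map x) = x;
  chart_map_cont : {within chart_dom, continuous chart_map};
  chart_inv_cont : {within chart_map @` chart_dom, continuous chart_inv} }.

Definition chart_cod (R : realType) (m : nat) (T : topologicalType)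
  (c : chart R m T) : set 'rV[R]_m := chart_map c @` chart_dom c.

Record smooth_manifold (R : realType) (m : nat) := SmoothManifold {
  mfd_space :> topologicalType;
  mfd_hausdorff : hausdorff_space mfd_space;
  mfd_second_countable : @second_countable mfd_space;
  mfd_atlas : set (chart R m mfd_space);
  mfd_atlas_cover : forall x, exists2 c, mfd_atlas c & chart_dom c x;
  mfd_atlas_smooth : forall c d, mfd_atlas c -> mfd_atlas d ->
    forall j : 'I_m, smooth_on (chart_map c @` (chart_dom c `&` chart_dom d))
                       (fun y => chart_map d (chart_inv c y) 0 j) }.

Section SmoothFunctions.
Context {R : realType} {m : nat} (M : smooth_manifold R m).

Definition smooth (f : M -> R) : Prop :=
  forall c, mfd_atlas c -> smooth_on (chart_cod c) (f \o chart_inv c).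

Lemma smooth_cst (a : R) : smooth (fun=> a).
Proof. by move=> c _ r; exact: Ck_on_cst. Qed.

Lemma smoothD f g : smooth f -> smooth g -> smooth (fun p => f p + g p).
Proof.
by move=> sf sg c Ac r; apply: Ck_onD;
  [exact: chart_cod_open|exact: sf|exact: sg].
Qed.

Lemma smoothM f g : smooth f -> smooth g -> smooth (fun p => f p * g p).
Proof.
by move=> sf sg c Ac r; apply: Ck_onM;
  [exact: chart_cod_open|exact: sf|exact: sg].
Qed.

Lemma smoothZ a f : smooth f -> smooth (fun p => a * f p).
Proof. by move=> sf; apply: smoothM => //; exact: smooth_cst. Qed.

Lemma smoothN f : smooth f -> smooth (fun p => - f p).
Proof.
move=> /(smoothZ (-1)); congr smooth.
by apply/funext => p; rewrite mulN1r.
Qed.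

Lemma smoothB f g : smooth f -> smooth g -> smooth (fun p => f p - g p).
Proof. by move=> sf sg; apply: smoothD => //; exact: smoothN. Qed.

Lemma smooth_sum (I : Type) (r : seq I) (f : I -> M -> R) :
  (forall i, smooth (f i)) -> smooth (fun p => \sum_(i <- r) f i p).
Proof.
move=> sf; elim: r => [|i r IH].
  by under eq_fun do rewrite big_nil; exact: smooth_cst.
by under eq_fun do rewrite big_cons; exact: smoothD.
Qed.

Definition smooth_pred : {pred M -> R} := fun f => `[< smooth f >].

Lemma smooth_predP f : reflect (smooth f) (f \in smooth_pred).
Proof. exact: asboolP. Qed.

Lemma smooth_pred_subring : subring_closed smooth_pred.
Proof.
split=> [|f g /smooth_predP sf /smooth_predP sg|
          f g /smooth_predP sf /smooth_predP sg]; apply/smooth_predP.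
- exact: smooth_cst.
- exact: smoothB.
- exact: smoothM.
Qed.

Lemma smooth_pred_submod : submod_closed smooth_pred.
Proof.
split=> [|a f g /smooth_predP sf /smooth_predP sg]; apply/smooth_predP.
  exact: smooth_cst.
by apply: smoothD => //; exact: smoothZ.
Qed.

HB.instance Definition _ :=
  GRing.isSubringClosed.Build (M -> R) smooth_pred smooth_pred_subring.
HB.instance Definition _ :=
  GRing.isSubmodClosed.Build R (M -> R) smooth_pred smooth_pred_submod.

(* C^infty(M) *)
Record smooth_fun := SmoothFun {
  smooth_fun_val :> M -> R;
  _ : smooth_fun_val \in smooth_pred }.

HB.instance Definition _ := [isSub for smooth_fun_val].
HB.instance Definition _ := [Choice of smooth_fun by <:].
HB.instance Definition _ := GRing.SubChoice_isSubComPzRing.Build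
  (M -> R) smooth_pred smooth_fun (subringClosedP _).
HB.instance Definition _ := [SubZmodule_isSubLmodule of smooth_fun by <:].

Definition mk_smooth (f : M -> R) (sf : smooth f) : smooth_fun :=
  SmoothFun (introT (smooth_predP f) sf).

Lemma smooth_funP (f : smooth_fun) : smooth f.
Proof. by apply/smooth_predP; case: f. Qed.

End SmoothFunctions.

Section Tangent.
Context {R : realType} {m : nat} (M : smooth_manifold R m).

Definition derivation_at (p : M) : {pred smooth_fun M -> R} := fun v =>
  `[< (forall (a : R) (f g : smooth_fun M), v (a *: f + g) = a * v f + v g) /\
      (forall f g : smooth_fun M, v (f * g) = f p * v g + g p * v f) >].

Lemma derivation_atP p v : reflect
  ((forall (a : R) (f g : smooth_fun M), v (a *: f + g) = a * v f + v g) /\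
   (forall f g : smooth_fun M, v (f * g) = f p * v g + g p * v f)) (v \in derivation_at p).
Proof. exact: asboolP. Qed.

Lemma derivation_at_submod p : submod_closed (derivation_at p).
Proof.
split=> [|a u v /derivation_atP[ul uM] /derivation_atP[vl vM]].
  have E h : (0 : smooth_fun M -> R) h = 0 by [].
  by apply/derivation_atP; split=> [a f g|f g]; rewrite !E !mulr0 addr0.
have E h : (a *: u + v) h = a * u h + v h by [].
apply/derivation_atP; split=> [b f g|f g]; rewrite !E.
  by rewrite ul vl; ring.
by rewrite uM vM; ring.
Qed.

HB.instance Definition _ p := GRing.isSubmodClosed.Build R (smooth_fun M -> R)
  (derivation_at p) (derivation_at_submod p).

(* T_p M, as the space of derivations of C^infty(M) at p *)
Record tangent (p : M) := Tangent {
  tangent_val :> smooth_fun M -> R;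
  _ : tangent_val \in derivation_at p }.

HB.instance Definition _ p := [isSub for @tangent_val p].
HB.instance Definition _ p := [Choice of tangent p by <:].
HB.instance Definition _ p := [SubChoice_isSubLmodule of tangent p by <:].


Lemma tangentP p (v : tangent p) :
  (forall (a : R) (f g : smooth_fun M), v (a *: f + g) = a * v f + v g) /\
  (forall f g : smooth_fun M, v (f * g) = f p * v g + g p * v f).
Proof. by apply/derivation_atP; case: v. Qed.

End Tangent.

Section Fields.
Context {R : realType} {m : nat} (M : smooth_manifold R m).

Record vector_field := VectorField {
  vf_at :> forall p : M, tangent p;
  vf_smooth : forall f : smooth_fun M, smooth (fun p => vf_at p f) }.

Definition lie_derive (X : vector_field) (f : smooth_fun M) : smooth_fun M :=
  mk_smooth (vf_smooth X f).

Fact lie_bracket_subproof (X Y : vector_field) (p : M) :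
  (fun f => X p (lie_derive Y f) - Y p (lie_derive X f)) \in derivation_at p.
Proof.
have lieL (Z : vector_field) (a : R) f g :
    lie_derive Z (a *: f + g) = a *: lie_derive Z f + lie_derive Z g.
  by apply/val_inj/funext => q /=; rewrite (tangentP (Z q)).1.
have lieM (Z : vector_field) f g :
    lie_derive Z (f * g) = f * lie_derive Z g + g * lie_derive Z f.
  by apply/val_inj/funext => q /=; rewrite (tangentP (Z q)).2.
have vD q (v : tangent q) f g : v (f + g) = v f + v g.
  by rewrite -[f]scale1r (tangentP v).1 mul1r scale1r.
apply/derivation_atP; split=> [a f g|f g].
  by rewrite !lieL !(tangentP _).1 mulrBr opprD addrACA.
rewrite !lieM !vD !(tangentP _).2 /=.
set a := X p f; set b := X p g; set c := Y p f; set d := Y p g.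
set e := X p (lie_derive Y g); set h := X p (lie_derive Y f).
set e' := Y p (lie_derive X g); set h' := Y p (lie_derive X f).
move: (f p) (g p) => u w; clearbody a b c d e h e' h'.
by rewrite !mulrBr; ring.
Qed.

Fact lie_bracket_smooth (X Y : vector_field) (f : smooth_fun M) :
  smooth (fun p => Tangent (lie_bracket_subproof X Y p) f).
Proof. by apply: smoothB; exact: vf_smooth. Qed.

Definition lie_bracket (X Y : vector_field) : vector_field :=
  VectorField (lie_bracket_smooth X Y).

Record one_form := OneForm {
  of_at :> forall p : M, {linear tangent p -> R};
  of_smooth : forall X : vector_field, smooth (fun p => of_at p (X p)) }.

Definition of_app (w : one_form) (X : vector_field) : smooth_fun M :=
  mk_smooth (of_smooth w X).

(* Convention without the factor 1/2. *)
Definition ext_deriv (w : one_form) (X Y : vector_field) : smooth_fun M :=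
  lie_derive X (of_app w Y) - lie_derive Y (of_app w X)
  - of_app w (lie_bracket X Y).

Record endo_field := EndoField {
  ef_at :> forall p : M, {linear tangent p -> tangent p};
  ef_smooth : forall (X : vector_field) (f : smooth_fun M),
    smooth (fun p => ef_at p (X p) f) }.

Record riemannian_metric := RiemannianMetric {
  metric_at :> forall p : M, tangent p -> tangent p -> R;
  metric_linear : forall p (a : R) (u v w : tangent p),
    metric_at (a *: u + v) w = a * metric_at u w + metric_at v w;
  metric_sym : forall p (u v : tangent p), metric_at u v = metric_at v u;
  metric_posdef : forall p (u : tangent p), u != 0 -> 0 < metric_at u u;
  metric_smooth : forall X Y : vector_field,
    smooth (fun p => metric_at (X p) (Y p)) }.

End Fields.

Definition is_basis (R : realType) (V : lmodType R) (W : set V) (d : nat)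
    (e : 'I_d -> V) : Prop :=
  (forall c : 'I_d -> R, \sum_i c i *: e i = 0 -> forall i, c i = 0) /\
  W = [set v | exists c : 'I_d -> R, v = \sum_i c i *: e i].

Record metric_fpk (R : realType) (n k : nat)
    (M : smooth_manifold R (2 * n + k)) := MetricFpk {
  fpk_phi : endo_field M;
  fpk_xi : 'I_k -> vector_field M;
  fpk_eta : 'I_k -> one_form M;
  fpk_g : riemannian_metric M;
  fpk_phi_rank : forall p, exists e : 'I_(2 * n) -> tangent p,
    is_basis [set v | exists u, v = fpk_phi p u] e;
  fpk_phi_cube : forall p v,
    fpk_phi p (fpk_phi p (fpk_phi p v)) + fpk_phi p v = 0;
  fpk_xi_frame : forall p,
    is_basis [set v | fpk_phi p v = 0] (fun i => fpk_xi i p);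
  fpk_eta_xi : forall i j p, fpk_eta i p (fpk_xi j p) = (i == j)%:R;
  fpk_eta_phi : forall j p v, fpk_eta j p (fpk_phi p v) = 0;
  fpk_phi_sq : forall p v,
    fpk_phi p (fpk_phi p v) = - v + \sum_i fpk_eta i p v *: fpk_xi i p;
  fpk_compat : forall p u v,
    fpk_g p u v = fpk_g p (fpk_phi p u) (fpk_phi p v)
                  + \sum_i fpk_eta i p u * fpk_eta i p v }.

Section AlmostS.
Context {R : realType} {n k : nat} {M : smooth_manifold R (2 * n + k)}.
Variable S : metric_fpk M.

Definition fundamental_form (p : M) (u v : tangent p) : R :=
  fpk_g S p (fpk_phi S p u) v.

Definition almost_S : Prop := forall (i : 'I_k) (X Y : vector_field M) (p : M),
  fundamental_form (X p) (Y p) = - ext_deriv (fpk_eta S i) X Y p.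

Lemma tangent_sumE (p : M) (u : 'I_k -> tangent p) (f : smooth_fun M) :
  (\sum_i u i) f = \sum_i u i f.
Proof.
by elim/big_rec2: _ => //= i x y _ <-.
Qed.

Fact xi_bar_smooth (f : smooth_fun M) :
  smooth (fun p => (\sum_i fpk_xi S i p) f).
Proof.
under eq_fun do rewrite tangent_sumE.
by apply: smooth_sum => i; exact: vf_smooth.
Qed.

Definition xi_bar : vector_field M := VectorField xi_bar_smooth.

Definition eta_bar_at (p : M) (v : tangent p) : R :=
  k%:R^-1 * \sum_i fpk_eta S i p v.

Fact eta_bar_linear (p : M) : linear (@eta_bar_at p).
Proof.
move=> a u v; rewrite /eta_bar_at.
under eq_bigr do rewrite linearP.
by rewrite big_split /= -scaler_sumr mulrDr scalerAr.
Qed.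

HB.instance Definition _ p :=
  GRing.isLinear.Build R (tangent p) R _ (@eta_bar_at p) (@eta_bar_linear p).

Fact eta_bar_smooth (X : vector_field M) : smooth (fun p => eta_bar_at (X p)).
Proof. by apply/smoothZ/smooth_sum => i; exact: of_smooth. Qed.

Definition eta_bar : one_form M :=
  @OneForm _ _ M (fun p => @eta_bar_at p) eta_bar_smooth.

(* X is the vector field X_f: i(X)eta^i = f for all i, and
   i(X)Phi = df - (xi_bar.f) eta_bar, as 1-forms evaluated on vector fields. *)
Definition is_hamiltonian (f : smooth_fun M) (X : vector_field M) : Prop :=
  (forall i : 'I_k, of_app (fpk_eta S i) X = f) /\
  (forall (Y : vector_field M) (p : M), fundamental_form (X p) (Y p) =
     lie_derive Y f p - lie_derive xi_bar f p * eta_bar p (Y p)).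

(* {f, g} in terms of X = X_f and Y = X_g *)
Definition jacobi_bracket (X Y : vector_field M) : smooth_fun M :=
  of_app eta_bar (lie_bracket X Y).

End AlmostS.

(* Main.v *)
Require Import Defs.
From mathcomp Require Import all_boot all_order all_algebra.
From mathcomp Require Import all_classical all_reals all_analysis.
From mathcomp Require Import ring.
Local Open Scope ring_scope.
Import Order.TTheory GRing.Theory Num.Theory.

(** For a Hamiltonian field [X = X_f], the equations [Phi = - d eta^i] and
    [i(X)Phi = df - (xi_bar.f) eta_bar] combine into the single rule
    [eta^i([X,W]) = X.eta^i(W) - (xi_bar.f) eta_bar(W)] for every field [W],
    and hence the same rule for [eta_bar]. With [W = X_g] it gives the bracket
    formula. Applied twice through the Jacobi identity it gives
    [Phi([X_f,X_g],Z) = Z.{f,g} - (X_f.xi_bar.g - X_g.xi_bar.f) eta_bar(Z)], and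
    [Z = xi_bar], which lies in the kernel of [Phi], identifies the coefficient
    as [xi_bar.{f,g}]. Uniqueness: the difference of two Hamiltonian fields of
    the same function is killed by all [eta^i] and by [phi]. *)

(** * Derivations, vector fields and metrics on a manifold *)

Section TangentFields.
Set Implicit Arguments.
Unset Strict Implicit.
Context {R : realType} {m : nat} {M : smooth_manifold R m}.

Lemma eq_tangent (p : M) (u v : tangent p) :
  (forall f : smooth_fun M, u f = v f) -> u = v.
Proof. by move=> uv; apply/val_inj/funext. Qed.

Lemma eq_vector_field (X Y : vector_field M) : (forall p, X p = Y p) -> X = Y.
Proof.
case: X Y => [X sX] [Y sY] /= XY.
have E : X = Y by apply: functional_extensionality_dep.
by case: Y / E sY {XY} => sY; congr VectorField; exact: Prop_irrelevance.
Qed.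

Lemma tangentB (p : M) (v : tangent p) (f g : smooth_fun M) :
  v (f - g) = v f - v g.
Proof.
by rewrite addrC -scaleN1r (tangentP v).1 mulN1r addrC.
Qed.

Lemma tangentM (p : M) (v : tangent p) (f g : smooth_fun M) :
  v (f * g) = f p * v g + g p * v f.
Proof. exact: (tangentP v).2. Qed.

Lemma tangentZ (p : M) (v : tangent p) (a : R) (f : smooth_fun M) :
  v (a *: f) = a * v f.
Proof.
have v0 : v 0 = 0 by rewrite -(subrr f) tangentB subrr.
by rewrite -[a *: f]addr0 (tangentP v).1 v0 addr0.
Qed.

Lemma tangent_sum (I : Type) (r : seq I) (p : M) (v : tangent p)
  (F : I -> smooth_fun M) : v (\sum_(i <- r) F i) = \sum_(i <- r) v (F i).
Proof.
elim: r => [|i r IH]; first by rewrite !big_nil -(subrr 0) tangentB subrr.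
by rewrite !big_cons -IH -[F i]scale1r (tangentP v).1 mul1r scale1r.
Qed.

Lemma smooth_fun_sumE (I : Type) (r : seq I) (F : I -> smooth_fun M) (p : M) :
  (\sum_(i <- r) F i) p = \sum_(i <- r) F i p.
Proof. by elim/big_rec2: _ => //= i x y _ <-. Qed.

Lemma lie_derive_bracket (X Y : vector_field M) (f : smooth_fun M) :
  lie_derive (lie_bracket X Y) f =
  lie_derive X (lie_derive Y f) - lie_derive Y (lie_derive X f).
Proof. exact/val_inj/funext. Qed.

(** Leibniz form of the Jacobi identity: on a test function both sides expand to the same
    alternating sum of triple derivatives. *)
Lemma lie_bracket_jacobi (X Y Z : vector_field M) (p : M) :
  lie_bracket (lie_bracket X Y) Z p =
  lie_bracket X (lie_bracket Y Z) p - lie_bracket Y (lie_bracket X Z) p.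
Proof.
apply: eq_tangent => f.
have E (A B : vector_field M) (h : smooth_fun M) :
  lie_bracket A B p h = A p (lie_derive B h) - B p (lie_derive A h) by [].
have subE (u v : tangent p) (h : smooth_fun M) : (u - v) h = u h - v h by [].
by rewrite subE !E !lie_derive_bracket !tangentB; ring.
Qed.

Lemma endo_app_smooth (F : endo_field M) (X : vector_field M)
  (f : smooth_fun M) : smooth (fun p => F p (X p) f).
Proof. exact: ef_smooth. Qed.

(** Makes [phi(X)] a global field, on which identities quantified over vector fields can be
    tested. *)
Definition endo_app (F : endo_field M) (X : vector_field M) : vector_field M :=
  VectorField (endo_app_smooth F X).

Lemma metricB (G : riemannian_metric M) (p : M) (u v w : tangent p) :
  G p (u - v) w = G p u w - G p v w.
Proof. by rewrite addrC -scaleN1r metric_linear mulN1r addrC. Qed.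

Lemma metricBr (G : riemannian_metric M) (p : M) (u v w : tangent p) :
  G p u (v - w) = G p u v - G p u w.
Proof. by rewrite !(Defs.metric_sym G u) metricB. Qed.

Lemma metric_r0 (G : riemannian_metric M) (p : M) (u : tangent p) :
  G p u 0 = 0.
Proof. by rewrite -(subrr u) metricBr subrr. Qed.

Lemma metric_eq0 (G : riemannian_metric M) (p : M) (u : tangent p) :
  G p u u = 0 -> u = 0.
Proof.
by move=> Gu; apply/eqP; apply: contraT => /(metric_posdef G); rewrite Gu ltxx.
Qed.

End TangentFields.

(** * Hamiltonian fields of an almost S-structure *)

Section AlmostSTheory.
Set Implicit Arguments.
Unset Strict Implicit.
Context {R : realType} {n k : nat} {M : smooth_manifold R (2 * n + k)}.
Variable S : metric_fpk M.

Lemma fpk_phi_xi (i : 'I_k) (p : M) : fpk_phi S p (fpk_xi S i p) = 0.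
Proof.
have [_ kerE] := fpk_xi_frame S p.
suff : [set v | fpk_phi S p v = 0]%classic (fpk_xi S i p) by [].
rewrite kerE; exists (fun j => (j == i)%:R).
rewrite (bigD1 i) //= eqxx scale1r big1 ?addr0 // => j /negPf ->.
by rewrite scale0r.
Qed.

(** By metric compatibility the value splits into a term containing [phi(xi_i) = 0] and terms
    containing [eta^i(phi u) = 0]. *)
Lemma fundamental_form_xi_bar (p : M) (u : tangent p) :
  fundamental_form S u (xi_bar S p) = 0.
Proof.
rewrite /fundamental_form fpk_compat /= linear_sum /=.
rewrite (eq_bigr (fun=> 0)) => [|i _]; last exact: fpk_phi_xi.
rewrite big1 // metric_r0 add0r big1 // => i _.
by rewrite fpk_eta_phi mul0r.
Qed.

Lemma eta_bar_mean (p : M) (v : tangent p) (a : R) : (0 < k)%N ->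
  (forall i, fpk_eta S i p v = a) -> eta_bar S p v = a.
Proof.
move=> k_gt0 va; rewrite /= /eta_bar_at (eq_bigr (fun=> a)) //.
rewrite sumr_const card_ord -[a *+ k]mulr_natl mulKf //.
by rewrite pnatr_eq0 -lt0n.
Qed.

Lemma eta_bar_xi_bar (p : M) : (0 < k)%N -> eta_bar S p (xi_bar S p) = 1.
Proof.
move=> k_gt0; apply: eta_bar_mean => // i; rewrite /= linear_sum /=.
rewrite (bigD1 i) //= fpk_eta_xi eqxx big1 ?addr0 // => j ji.
by rewrite fpk_eta_xi eq_sym (negPf ji).
Qed.

Lemma hamiltonian_unique (f : smooth_fun M) (X Y : vector_field M) :
  is_hamiltonian S f X -> is_hamiltonian S f Y -> X = Y.
Proof.
move=> [etaX PhiX] [etaY PhiY]; apply: eq_vector_field => p.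
have eta0 i : fpk_eta S i p (X p - Y p) = 0.
  rewrite linearB /=; apply/eqP; rewrite subr_eq0; apply/eqP.
  by have := congr1 (fun h : smooth_fun M => h p) (etrans (etaX i) (esym (etaY i))).
have Phi0 (Z : vector_field M) : fpk_g S p (fpk_phi S p (X p - Y p)) (Z p) = 0.
  rewrite linearB /= metricB; apply/eqP; rewrite subr_eq0; apply/eqP.
  exact: etrans (PhiX Z p) (esym (PhiY Z p)).
have phi0 : fpk_phi S p (X p - Y p) = 0.
  (* [Phi0] only covers values of global fields; [phi(X - Y)] is a difference of two of these, so it
     is orthogonal to itself. *)
  apply: (@metric_eq0 _ _ _ (fpk_g S)).
  rewrite [X in fpk_g S p _ X]linearB metricBr.
  rewrite (Phi0 (endo_app (fpk_phi S) X)) (Phi0 (endo_app (fpk_phi S) Y)).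
  exact: subrr.
(* With [d = X p - Y p], the formula for [phi^2 d] now reads [0 = - d]. *)
have := fpk_phi_sq S (X p - Y p); rewrite phi0 linear0 big1.
  by rewrite addr0 => /esym/eqP; rewrite oppr_eq0 subr_eq0 => /eqP.
by move=> i _; rewrite eta0 scale0r.
Qed.

Hypotheses (k_gt0 : (0 < k)%N) (hS : almost_S S).

Lemma eta_bar_hamiltonian (f : smooth_fun M) (X : vector_field M) :
  is_hamiltonian S f X -> of_app (eta_bar S) X = f.
Proof.
move=> [etaX _]; apply/val_inj/funext => p.
by apply: eta_bar_mean => // i; rewrite -(etaX i).
Qed.

(** Since [eta^i(X) = f], the term [W.f] occurs in both expressions for [Phi(X,W)] and cancels. *)
Lemma eta_lie_bracket_hamiltonian (f : smooth_fun M) (X W : vector_field M)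
    (i : 'I_k) : is_hamiltonian S f X ->
  of_app (fpk_eta S i) (lie_bracket X W) =
  lie_derive X (of_app (fpk_eta S i) W)
  - lie_derive (xi_bar S) f * of_app (eta_bar S) W.
Proof.
move=> [etaX PhiX]; apply/val_inj/funext => p.
have := PhiX W p; rewrite (hS i) /ext_deriv (etaX i).
set A := lie_derive X _; set B := of_app _ (lie_bracket _ _).
set C := lie_derive W f; set D := lie_derive _ f; set E := eta_bar S p _.
change (- (A p - C p - B p) = C p - D p * E -> B p = A p - D p * E).
move=> H; have -> : B p = - (A p - C p - B p) - C p + A p by ring.
by rewrite H; ring.
Qed.

(** Average of the previous rule over [i]: the correction term is the same for every [i], and
    [0 < k] lets the mean of [k] copies return it. *)
Lemma eta_bar_lie_bracket_hamiltonian (f : smooth_fun M)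
    (X W : vector_field M) : is_hamiltonian S f X ->
  of_app (eta_bar S) (lie_bracket X W) =
  lie_derive X (of_app (eta_bar S) W)
  - lie_derive (xi_bar S) f * of_app (eta_bar S) W.
Proof.
move=> hX.
have barE : of_app (eta_bar S) W = k%:R^-1 *: \sum_i of_app (fpk_eta S i) W.
  apply/val_inj/funext => p.
  change (k%:R^-1 * \sum_i of_app (fpk_eta S i) W p =
    k%:R^-1 * (\sum_i of_app (fpk_eta S i) W) p).
  by rewrite smooth_fun_sumE.
apply/val_inj/funext => p.
set D := lie_derive (xi_bar S) f; set C := of_app (eta_bar S) W.
change (k%:R^-1 * \sum_i of_app (fpk_eta S i) (lie_bracket X W) p =
  X p C - D p * C p).
have -> : X p C = k%:R^-1 * \sum_i X p (of_app (fpk_eta S i) W).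
  by rewrite /C barE tangentZ tangent_sum.
rewrite (eq_bigr (fun i => X p (of_app (fpk_eta S i) W) - D p * C p)).
  rewrite sumrB mulrBr sumr_const card_ord; congr (_ - _).
  rewrite -[(D p * C p) *+ k]mulr_natl mulKf //.
  by rewrite pnatr_eq0 -lt0n.
by move=> i _; rewrite (eta_lie_bracket_hamiltonian _ _ hX).
Qed.

Lemma lie_bracket_hamiltonian (f g : smooth_fun M) (X Y : vector_field M) :
  is_hamiltonian S f X -> is_hamiltonian S g Y ->
  is_hamiltonian S (jacobi_bracket S X Y) (lie_bracket X Y).
Proof.
move=> hX hY; set h := jacobi_bracket S X Y.
(* Both [eta^i(Y)] and [eta_bar(Y)] equal [g], so the two bracket rules give the same value. *)
have etaXY i : of_app (fpk_eta S i) (lie_bracket X Y) = h.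
  rewrite /h /jacobi_bracket (eta_bar_lie_bracket_hamiltonian _ hX).
  rewrite (eta_lie_bracket_hamiltonian _ _ hX) (eta_bar_hamiltonian hY).
  by case: hY => ->.
split=> // Z p; have i0 : 'I_k := Ordinal k_gt0.
set a := lie_derive (xi_bar S) f; set b := lie_derive (xi_bar S) g.
have PhiE (W : vector_field M) :
    fundamental_form S (lie_bracket X Y p) (W p) =
    W p h - (X p b - Y p a) * eta_bar S p (W p).
  rewrite (hS i0) /ext_deriv etaXY.
  (* After Jacobi every bracket in sight has a Hamiltonian field on its left, so the bracket rule
     applies twice. *)
  have -> : of_app (fpk_eta S i0) (lie_bracket (lie_bracket X Y) W) =
      of_app (fpk_eta S i0) (lie_bracket X (lie_bracket Y W)) -
      of_app (fpk_eta S i0) (lie_bracket Y (lie_bracket X W)).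
    apply/val_inj/funext => q; apply: etrans (linearB (fpk_eta S i0 q) _ _).
    by congr (fpk_eta S i0 q _); exact: lie_bracket_jacobi.
  rewrite !(eta_lie_bracket_hamiltonian _ _ hX,
            eta_lie_bracket_hamiltonian _ _ hY).
  rewrite (eta_bar_lie_bracket_hamiltonian _ hX).
  rewrite (eta_bar_lie_bracket_hamiltonian _ hY) -/a -/b lie_derive_bracket.
  set u := of_app (fpk_eta S i0) W; set v := of_app (eta_bar S) W.
  have -> : eta_bar S p (W p) = v p by [].
  have subE (x y : smooth_fun M) : (x - y) p = x p - y p by [].
  have mulE (x y : smooth_fun M) : (x * y) p = x p * y p by [].
  have lieE (A : vector_field M) (x : smooth_fun M) :
    lie_derive A x p = A p x by [].
  (* The second derivatives of [u] cancel, as do the terms [a * Y.v], [b * X.v] and [a * b * v];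
     only [X.b - Y.a] survives as coefficient of [v]. *)
  rewrite !(subE, mulE, lieE, tangentB, tangentM) /=.
  by ring.
have := PhiE (xi_bar S).
rewrite fundamental_form_xi_bar eta_bar_xi_bar // mulr1.
move/esym/eqP; rewrite subr_eq0 => /eqP hE.
by rewrite PhiE -hE.
Qed.

End AlmostSTheory.

(** The field [X_h] is represented by the predicate [is_hamiltonian], so an equality with [X_h]
    takes the form of [unique]. *)
Theorem proposition5p3 (R : realType) (n k : nat) (k_gt0 : (0 < k)%N)
    (M : smooth_manifold R (2 * n + k)) (S : metric_fpk M) (hS : almost_S S)
    (f g : smooth_fun M) (Xf Xg : vector_field M)
    (hf : is_hamiltonian S f Xf) (hg : is_hamiltonian S g Xg) :
  jacobi_bracket S Xf Xg = lie_derive Xf g - lie_derive (xi_bar S) f * g /\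
  unique (is_hamiltonian S (jacobi_bracket S Xf Xg)) (lie_bracket Xf Xg).
Proof.
have hfg := lie_bracket_hamiltonian k_gt0 hS hf hg.
split; last by split=> // Z; exact: hamiltonian_unique.
rewrite /jacobi_bracket (eta_bar_lie_bracket_hamiltonian k_gt0 hS _ hf).
by rewrite (eta_bar_hamiltonian k_gt0 hg).
Qed.
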